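(* Let $T$ be an ergodic automorphism of a standard probability Borel space $(X,\mathcal{B},\mu)$ with $\mu$ non-atomic, and let $f\in L^2(X,\mu)$ with $f\ge c$ for some $c>0$. Suppose there are measurable sets $W_n\subset X$, increasing sequences of natural numbers $\{q_n\}$, $\{q_n'\}$, real sequences $\{a_n\}$, $\{a_n'\}$, a number $0<\alpha\le 1$ and $P\in\mathcal{P}(\mathbb{R}^2)$ such that: (C1) $\mu(W_n)\to\alpha$; (C2) $\mu(W_n\triangle T^{-1}W_n)\to 0$; (C3) $\{q_n\}$ is a rigidity sequence for $T$ along $\{W_n\}$; (C4) $\{q_n'\}$ is a rigidity sequence for $T$ along $\{W_n\}$; (C5) $\{\int_{W_n}|f_n|^2d\mu\}_n$ is bounded, where $f_n=f^{(q_n)}-a_n$; (C6) $\{\int_{W_n}|f_n'|^2d\mu\}_n$ is bounded, where $f_n'=f^{(q_n')}-a_n'$; (C7) $(f_n',f_n)_*(\mu_{W_n})\to P$ weakly in $\mathcal{P}(\mathbb{R}^2)$. Let $h,h':X\to\mathbb{R}$ be measurable, $g\in L^\infty(X,\mathcal{B},\mu)$ and $\phi:\mathbb{R}^2\to\mathbb{R}$ bounded and uniformly continuous. Then \[\int_{W_n}\phi\big(f_n'(x)+h'(x),f_n(x)+h(x)\big)g(x)\,d\mu(x)\to\alpha\int_X\int_{\mathbb{R}^2}\phi\big(t+h'(x),u+h(x)\big)g(x)\,dP(t,u)\,d\mu(x).\]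
   Context: For $n\in\mathbb{Z}$: $f^{(n)}=f+f\circ T+\cdots+f\circ T^{n-1}$ for $n>0$, $f^{(0)}=0$, $f^{(n)}=-(f\circ T^{-1}+\cdots+f\circ T^{n})$ for $n<0$. $\mu_W(A)=\mu(A\cap W)/\mu(W)$ is the conditional measure. $\{q_n\}$ is a rigidity sequence for $T$ along $\{W_n\}$ if $\mu((T^{-q_n}A\triangle A)\cap W_n)\to 0$ for all $A\in\mathcal{B}$. $\mathcal{P}(\mathbb{R}^k)$ is the space of Borel probability measures on $\mathbb{R}^k$. *)

(* Defs.v *)
From HB Require Import structures.
From mathcomp Require Import all_boot all_order all_algebra.
From mathcomp Require Import all_classical all_reals all_analysis.
Import Order.TTheory GRing.Theory Num.Theory.
Import numFieldNormedType.Exports.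
Local Open Scope classical_set_scope.
Local Open Scope ring_scope.

Set Implicit Arguments.
Unset Strict Implicit.
Unset Printing Implicit Defensive.

Definition symdiff (T : Type) (A B : set T) : set T := (A `\` B) `|` (B `\` A).

(* (X, B) is a standard Borel space: Borel-isomorphic to a Borel subset of R
   (Kuratowski: every standard Borel space is of this form). *)
Definition standard_borel d (X : measurableType d) (R : realType) : Prop :=
  exists (e : X -> R) (B : set R),
    [/\ measurable B, measurable_fun setT e, injective e, range e = B
      & forall A : set X, measurable A -> measurable (e @` A)].

Definition nonatomic d (X : measurableType d) (R : realType)
  (mu : set X -> \bar R) : Prop :=
  forall A, measurable A -> (0 < mu A)%E ->
    exists2 B, measurable B /\ B `<=` A & (0 < mu B)%E /\ (mu B < mu A)%E.

Definition mp_automorphism d (X : measurableType d) (R : realType)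
  (mu : set X -> \bar R) (T : X -> X) : Prop :=
  [/\ bijective T, measurable_fun setT T,
      (forall A, measurable A -> measurable (T @` A))
    & forall A, measurable A -> mu (T @^-1` A) = mu A].

Definition ergodic d (X : measurableType d) (R : realType)
  (mu : set X -> \bar R) (T : X -> X) : Prop :=
  forall A, measurable A -> T @^-1` A = A -> mu A = 0%E \/ mu A = 1%E.

Definition cocycle (X : Type) (R : realType) (T : X -> X) (f : X -> R)
  (n : nat) : X -> R :=
  fun x => \sum_(k < n) f (iter k T x).

Definition rigidity_seq d (X : measurableType d) (R : realType)
  (mu : set X -> \bar R) (T : X -> X) (q : nat -> nat) (W : nat -> set X) :=
  forall A, measurable A ->
    (fun n => mu (symdiff (iter (q n) T @^-1` A) A `&` W n)) @ \oo --> 0%E.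

(* Weak convergence (F_n)_*(mu_{W_n}) -> P in P(R^2), where
   mu_W(A) = mu(A /\ W)/mu(W) is the conditional measure.  The integral of a
   test function phi against (F_n)_*(mu_{W_n}) is written out as
   (1/mu(W_n)) * \int_{W_n} phi(F_n x) dmu(x). *)
Definition weak_cvg_cond d (X : measurableType d) (R : realType)
  (mu : {measure set X -> \bar R}) (W : nat -> set X)
  (F : nat -> X -> (R * R)%type) (P : {measure set (R * R)%type -> \bar R})
  : Prop :=
  forall phi : (R * R)%type -> R, continuous phi ->
    (exists M : R, forall z, `|phi z| <= M) ->
    (fun n => ((fine (mu (W n)))^-1)%:E * \int[mu]_(x in W n) (phi (F n x))%:E)%E
      @ \oo --> (\int[P]_z (phi z)%:E)%E.

(* Main.v *)
(** Let [u_n = 1_{W_n} phi (f'_n + v', f_n + v)] for constants [v', v].  Since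
    [f_n \o T - f_n = f \o T^{q_n} - f] tends to [0] in measure on [W_n] by
    rigidity, and [W_n] is almost invariant, the set functions
    [A |-> \int_A u_n - mu A * \int u_n] are asymptotically [T]-invariant.  A limit
    of them along an ultrafilter is a [T]-invariant charge of total mass [0]
    dominated by [mu]; a positive set of its Hahn decomposition can be made
    strictly invariant, so by ergodicity the charge vanishes.  Hence
    [\int_A u_n -> alpha * mu A * \int phi (z + (v', v)) dP(z)] for every [A], and
    [h', h, g] may be replaced by constants on the cells of a countable partition
    on which they vary little. *)

Require Import Defs.
From HB Require Import structures.
From mathcomp Require Import all_boot all_order all_algebra.
From mathcomp Require Import ring lra.
From mathcomp Require Import all_classical all_reals all_analysis.
From mathcomp Require Import measurable_realfun.
Import Order.TTheory GRing.Theory Num.Theory.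
Import numFieldNormedType.Exports.
Local Open Scope classical_set_scope.
Local Open Scope ring_scope.

Set Implicit Arguments.
Unset Strict Implicit.
Unset Printing Implicit Defensive.

(** * Convergence of real sequences along filters *)

(** Compactness of the segment gives the image filter a cluster point, and an ultrafilter converges
    to each of its cluster points. *)
Lemma ultra_bounded_cvg (R : realType) (U : set_system nat) (x : nat -> R)
    (C : R) :
  UltraFilter U -> (forall n, `|x n| <= C) -> cvg (x @ U).
Proof.
move=> UU xC.
have xU : (x @ U) `[- C, C]%classic.
  by apply: (@filterE _ U) => n /=; rewrite in_itv/= -ler_norml.
have [p [_ clp]] := @segment_compact R (- C) C (x @ U) _ xU.
apply/cvg_ex; exists p => V nV.
have [//|UVc] := in_ultra_setVsetC (x @^-1` V) UU.
by have [y []] := clp (~` V) V UVc nV.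
Qed.

Lemma cvg_dist_le (R : realType) (x y : nat -> R) (l : R) :
  (forall n, `|l - x n| <= y n) -> y n @[n --> \oo] --> 0 ->
  x n @[n --> \oo] --> l.
Proof.
move=> xy y0; apply/cvgrPdist_le => e e0; near=> n.
apply: le_trans (xy n) _; apply: le_trans (ler_norm _) _.
by near: n; exact: cvgr0_norm_le.
Unshelve. all: by end_near. Qed.

(** * Additive set functions dominated by a probability, and ergodicity *)

Section dominated_additive.
Context d (X : measurableType d) (R : realType) (mu : probability X R).
Implicit Types (A B : set X) (k : set X -> R) (C : R).

Definition prob A : R := fine (mu A).

Lemma probE A : measurable A -> (prob A)%:E = mu A.
Proof. by move=> mA; rewrite fineK// fin_num_measure. Qed.

Lemma prob_ge0 A : 0 <= prob A.
Proof. exact: fine_ge0. Qed.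

Lemma prob_le1 A : measurable A -> prob A <= 1.
Proof. by move=> mA; rewrite -lee_fin (probE mA) probability_le1. Qed.

Lemma probT : prob setT = 1.
Proof. by rewrite /prob probability_setT. Qed.

Lemma prob_le A B : measurable A -> measurable B ->
  A `<=` B -> prob A <= prob B.
Proof. by move=> mA mB AB; rewrite fine_le ?fin_num_measure// le_measure ?inE. Qed.

(** Both clauses survive pointwise limits along an ultrafilter. Countable additivity is derived from
    the bound, through continuity of [mu] along monotone sequences. *)
Definition dominated_additive C k :=
  (forall A B, measurable A -> measurable B -> A `&` B = set0 ->
    k (A `|` B) = k A + k B) /\
  (forall A, measurable A -> `|k A| <= C * prob A).

Lemma dominated_additive_prob : dominated_additive 1 prob.
Proof.
split=> [A B mA mB AB|A mA]; last by rewrite mul1r ger0_norm ?prob_ge0.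
by rewrite /prob measureU// fineD ?fin_num_measure.
Qed.

Lemma prob_cvg_bigcup (F : nat -> set X) : (forall n, measurable (F n)) ->
  nondecreasing_seq F -> prob (F n) @[n --> \oo] --> prob (\bigcup_n F n).
Proof.
move=> mF ndF; apply: fine_cvg.
rewrite (probE (bigcupT_measurable _ mF)).
by apply: nondecreasing_cvg_mu => //; exact: bigcupT_measurable.
Qed.

Lemma prob_cvg_bigcap (F : nat -> set X) : (forall n, measurable (F n)) ->
  nonincreasing_seq F -> prob (F n) @[n --> \oo] --> prob (\bigcap_n F n).
Proof.
move=> mF niF; apply: fine_cvg.
rewrite (probE (bigcapT_measurable mF)).
apply: nonincreasing_cvg_mu => //; last exact: bigcapT_measurable.
by rewrite ltey_eq fin_num_measure.
Qed.

Section theory.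
Variables (C : R) (k : set X -> R).
Hypothesis kC : dominated_additive C k.

Lemma dominated_additiveD A B : measurable A -> measurable B -> A `<=` B ->
  k (B `\` A) = k B - k A.
Proof.
move=> mA mB AB; have mBA := measurableD mB mA.
have := kC.1 _ _ mA mBA (setDIK A B); rewrite setDUK// => ->.
by rewrite addrAC subrr add0r.
Qed.

Lemma dominated_additive0 : k set0 = 0.
Proof.
by rewrite -(setDv set0) dominated_additiveD// subrr.
Qed.

Lemma dominated_additiveUI A B : measurable A -> measurable B ->
  k (A `|` B) + k (A `&` B) = k A + k B.
Proof.
move=> mA mB; have mAB := measurableI _ _ mA mB.
have mAB' := measurableD mA mB.
have -> : A `|` B = (A `\` B) `|` B by rewrite setUDl setDv setD0.
rewrite kC.1//; last by rewrite setDE -setIA setICl setI0.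
rewrite -[X in _ = k X + _](setUIDK A B) (kC.1 (A `&` B))//; last first.
  by rewrite setDE setIACA setICr setI0.
by rewrite addrC addrA.
Qed.

End theory.

Lemma prob_setU_le A B : measurable A -> measurable B ->
  prob (A `|` B) <= prob A + prob B.
Proof.
move=> mA mB; have := dominated_additiveUI dominated_additive_prob mA mB.
by have := prob_ge0 (A `&` B); lra.
Qed.

Section continuity.
Variables (C : R) (k : set X -> R).
Hypothesis kC : dominated_additive C k.

Lemma dominated_additive_dist A B : measurable A -> measurable B -> A `<=` B ->
  `|k B - k A| <= C * (prob B - prob A).
Proof.
move=> mA mB AB; rewrite -(dominated_additiveD kC)//.
rewrite -(dominated_additiveD dominated_additive_prob)//.
by apply: kC.2; exact: measurableD.
Qed.

Lemma dominated_additive_cvg_bigcup (F : nat -> set X) :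
  (forall n, measurable (F n)) -> nondecreasing_seq F ->
  k (F n) @[n --> \oo] --> k (\bigcup_n F n).
Proof.
move=> mF ndF; have mU := bigcupT_measurable _ mF.
apply: (@cvg_dist_le _ _ (fun n => C * (prob (\bigcup_n F n) - prob (F n)))).
  by move=> n; apply: dominated_additive_dist => //; exact: bigcup_sup.
rewrite -(mulr0 C) -(subrr (prob (\bigcup_n F n))).
by apply: cvgMr; apply: cvgB; [exact: cvg_cst|exact: prob_cvg_bigcup].
Qed.

Lemma dominated_additive_cvg_bigcap (F : nat -> set X) :
  (forall n, measurable (F n)) -> nonincreasing_seq F ->
  k (F n) @[n --> \oo] --> k (\bigcap_n F n).
Proof.
move=> mF niF; have mI := bigcapT_measurable mF.
apply: (@cvg_dist_le _ _ (fun n => C * (prob (F n) - prob (\bigcap_n F n)))).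
  by move=> n; rewrite distrC dominated_additive_dist//; exact: bigcap_inf.
rewrite -(mulr0 C) -(subrr (prob (\bigcap_n F n))).
by apply: cvgMr; apply: cvgB; [exact: prob_cvg_bigcap|exact: cvg_cst].
Qed.

(** Carrying the proof as an argument lets a charge structure be attached to this name, since the
    charge axioms rest on that proof. *)
Definition charge_of_dominated_additive (_ : dominated_additive C k) :
  set X -> \bar R := fun A => (k A)%:E.

Local Notation nu := (charge_of_dominated_additive kC).

Let nu0 : nu set0 = 0%E.
Proof. by congr EFin; exact: dominated_additive0 kC. Qed.

Let nu_finite A : measurable A -> nu A \is a fin_num.
Proof. by []. Qed.

Let nu_sigma_additive : semi_sigma_additive nu.
Proof.
move=> F mF tF mU.
have mB n : measurable (\big[setU/set0]_(i < n) F i).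
  by apply: bigsetU_measurable.
have FE n : (\sum_(0 <= i < n) nu (F i) = (k (\big[setU/set0]_(i < n) F i))%:E)%E.
  elim: n => [|n IHn]; first by rewrite big_nil big_ord0 -nu0.
  rewrite big_nat_recr//= IHn big_ord_recr/= (kC.1 _ _ (mB n))//.
  by apply: (trivIset_bigsetUI (D := xpredT)) => //; exact: sub_trivIset tF.
under eq_fun do rewrite FE.
apply/cvg_EFin; first exact: nearW.
(* Partial sums are values of [k] on finite unions. The index is shifted by one to match the unions
   over [i < n.+1] that exhaust the countable union, so that continuity from below applies. *)
rewrite -bigcup_bigsetU_bigcup -cvg_shiftS/=.
apply: (@dominated_additive_cvg_bigcup
  (fun n => \big[setU/set0]_(i < n.+1) F i)) => //.
apply/nondecreasing_seqP => n.
by rewrite [in leRHS]big_ord_recr/=; apply/subsetPset/subsetUl.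
Qed.

HB.instance Definition _ := isCharge.Build _ X R nu
  nu0 nu_finite nu_sigma_additive.

(** The positive set of a Hahn decomposition works: discarding the part of [A] outside [P] removes
    nonpositive mass, and adding the rest of [P] adds nonnegative mass. *)
Lemma dominated_additive_argmax : exists2 P, measurable P &
  forall A, measurable A -> k A <= k P.
Proof.
have [P [N [[mP posP] [mN negN] PN PN0]]] := Hahn_decomposition nu.
exists P => // A mA.
have NP : ~` P `<=` N.
  by move=> x Px; have : [set: X] x by []; rewrite -PN => -[].
have mAP := measurableI _ _ mA mP.
rewrite -(setUIDK A P) kC.1//; last 2 first.
- exact: measurableD.
- by rewrite -subset0 => x [[_ Px] [_ /(_ Px)]].
have : k (A `\` P) <= 0.
  rewrite -lee_fin; apply: negN; first exact: measurableD.
  by move=> x [_ /NP].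
have : 0 <= k (P `\` (A `&` P)).
  by rewrite -lee_fin; apply: posP; [exact: measurableD|exact: subDsetl].
rewrite (dominated_additiveD kC mAP mP)//; lra.
Qed.

(** By ergodicity a strictly invariant maximizer of [k] is null or of full measure. Domination and
    [k setT = 0] then make the maximum of [k] zero. *)
Lemma dominated_additive_invariant (T : X -> X) :
  measurable_fun setT T -> ergodic mu T ->
  (forall A, measurable A -> k (T @^-1` A) = k A) -> k setT = 0 ->
  forall A, measurable A -> k A = 0.
Proof.
move=> mT ergT kT kX.
have [P mP maxP] := dominated_additive_argmax.
(* The values on union and intersection add up to [2 * k P], and the union takes at most [k P], so
   the intersection takes at least [k P]. *)
have maxI (A B : set X) : measurable A -> measurable B ->
    k A = k P -> k B = k P -> k (A `&` B) = k P.
  move=> mA mB kA kB; apply/le_anti/andP; split.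
    by apply: maxP; exact: measurableI.
  have := dominated_additiveUI kC mA mB.
  have := maxP _ (measurableU _ _ mA mB); lra.
(* The liminf [B] of the preimages of [P] is strictly invariant and still
   maximizes [k], since maximizers are stable under intersections and monotone
   limits. *)
pose D n := iter n T @^-1` P.
have mD n : measurable (D n) /\ k (D n) = k P.
  elim: n => [//|n [mDn kDn]].
  have -> : D n.+1 = T @^-1` D n by apply/funext => x; rewrite /D/= -iterSr.
  by rewrite kT//; split=> //; rewrite -[_ @^-1` _]setTI; exact: mT.
(* Finite intersections come first: [maxI] treats them by induction, and continuity from above then
   reaches the infinite intersections [E n]. *)
pose I n j := \bigcap_(i < j.+1) D (n + i)%N.
have mI n j : measurable (I n j).
  by apply: bigcap_measurableType => // i _; exact: (mD _).1.
have kI n j : k (I n j) = k P.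
  elim: j => [|j IHj].
    by rewrite /I bigcap_mkord big_ord1; exact: (mD _).2.
  have -> : I n j.+1 = I n j `&` D (n + j.+1)%N.
    rewrite /I bigcap_mkord big_ord_recr/=.
    by rewrite -(bigcap_mkord _ (fun i => D (n + i)%N)).
  by apply: maxI => //; [exact: (mD _).1|exact: (mD _).2].
pose E n := \bigcap_i D (n + i)%N.
have EI n : E n = \bigcap_j I n j.
  apply/seteqP; split=> [x Ex j _ i _|x Ix i _]; first exact: Ex.
  by apply: (Ix i) => /=.
have kE n : k (E n) = k P.
  have : k (I n j) @[j --> \oo] --> k (E n).
    rewrite EI; apply: dominated_additive_cvg_bigcap => // i j ij.
    by apply/subsetPset => x + l /= lj; apply; exact: leq_trans ij.
  under eq_fun do rewrite kI.
  by move/cvg_lim => <- //; rewrite lim_cst.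
have mE n : measurable (E n) by rewrite EI; exact: bigcapT_measurable.
pose B := \bigcup_n E n.
have mB : measurable B by exact: bigcupT_measurable.
have kB : k B = k P.
  have : k (E n) @[n --> \oo] --> k B.
    apply: dominated_additive_cvg_bigcup => // i j ij.
    apply/subsetPset => x Ex l _.
    rewrite -(subnK ij) -addnA (addnC (j - i)%N) -addnA.
    exact: Ex.
  under eq_fun do rewrite kE.
  by move/cvg_lim => <- //; rewrite lim_cst.
(* The preimage of [E n] under [T] is [E n.+1], and the increasing union over [n] does not change
   under this shift. *)
have TB : T @^-1` B = B.
  apply/seteqP; split=> x [n _ Ex].
    by exists n.+1 => // i _; have := Ex i Logic.I; rewrite /D/= -iterSr -addSn.
  exists n => // i _; have := Ex i.+1 Logic.I.
  by rewrite /D/= -iterSr addnS.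
have kP : k P = 0.
  rewrite -kB; case: (ergT _ mB TB) => muB.
    by apply/eqP; rewrite -normr_le0 (le_trans (kC.2 _ mB))// /prob muB mulr0.
  have mBC : measurable (~` B) by exact: measurableC.
  have := kC.1 _ _ mB mBC (setICr B); rewrite setUCr kX.
  have : k (~` B) = 0.
    apply/eqP; rewrite -normr_le0 (le_trans (kC.2 _ mBC))//.
    by rewrite /prob probability_setC// muB subee// mulr0.
  lra.
(* [A] and its complement both have [k] at most [0], and the two values sum to [0]. *)
move=> A mA; have mAC : measurable (~` A) by exact: measurableC.
have := kC.1 _ _ mA mAC (setICr A); rewrite setUCr kX.
have := maxP _ mA; have := maxP _ mAC; lra.
Qed.

End continuity.

(* The domination [`|k A| <= C mu A] is what makes the limit along an ultrafilter,
   a priori only finitely additive, countably additive. *)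
Lemma ergodic_cvg (C : R) (T : X -> X) (k : nat -> set X -> R) :
  measurable_fun setT T -> ergodic mu T ->
  (forall n, dominated_additive C (k n)) -> (forall n, k n setT = 0) ->
  (forall A, measurable A -> k n (T @^-1` A) - k n A @[n --> \oo] --> 0) ->
  forall A, measurable A -> k n A @[n --> \oo] --> 0.
Proof.
move=> mT ergT kC kX kT A mA; apply/cvgr0Pnorm_lt => e e0.
apply: contrapT => nlt.
(* If the claim fails, [S] meets every final segment. An ultrafilter containing [S] and all final
   segments keeps the assumed limits in [n] while [|k n A|] stays at least [e] along it. *)
pose S := [set n | e <= `|k n A|].
have SF : ProperFilter (within S \oo).
  apply: Build_ProperFilter => S0; apply: nlt.
  move: S0; rewrite /within/=; apply: filterS => n Sn.
  by rewrite ltNge; apply/negP => /Sn.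
have [U [UU SU]] := ultraFilterLemma SF.
have ooU : \oo `<=` U by move=> V /(cvg_within S) /SU.
have kcvg B : measurable B -> cvg (k n B @[n --> U]).
  move=> mB; apply: (@ultra_bounded_cvg _ _ _ (C * prob B)) => n.
  exact: (kC n).2.
pose l B := lim (k n B @[n --> U]).
have kl B : measurable B -> k n B @[n --> U] --> l B by exact: kcvg.
have lC : dominated_additive C l.
  split=> [B D mB mD BD|B mB].
    apply: cvg_lim => //.
    under eq_fun do rewrite (kC _).1//.
    by apply: cvgD; exact: kl.
  have /cvgr_to_le : `|k n B| @[n --> U] --> `|l B| by apply: cvg_norm; exact: kl.
  by apply; apply: filterE => n; exact: (kC n).2.
have l0 : l A = 0.
  apply: (dominated_additive_invariant lC mT ergT) => // [B mB|].
    have mTB : measurable (T @^-1` B) by rewrite -[_ @^-1` _]setTI; exact: mT.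
    apply/subr0_eq.
    have /cvg_lim <- // : k n (T @^-1` B) - k n B @[n --> U] --> l (T @^-1` B) - l B.
      by apply: cvgB; exact: kl.
    by apply: cvg_lim => //; apply: cvg_trans (kT _ mB); exact: cvg_app.
  by apply: cvg_lim => //; under eq_fun do rewrite kX; exact: cvg_cst.
have : e <= `|l A|.
  have /cvgr_to_ge : `|k n A| @[n --> U] --> `|l A| by apply: cvg_norm; exact: kl.
  by apply; apply: SU; exact: withinT.
by rewrite l0 normr0 leNgt e0.
Qed.

End dominated_additive.

(** * Passing from the cells of a countable cover to all sets *)

Section local.
Context d (X : measurableType d) (R : realType) (mu : probability X R).
Local Notation prob := (prob mu).

(** After the cover is made disjoint, finitely many cells carry nearly all the mass of the set, and
    domination controls the rest uniformly in [n]. Errors proportional to [prob] add up to at most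
    [eps]; the slack [e] absorbs what remains on each cell. *)
Lemma local_cvg (C : R) (k : nat -> set X -> R) :
  (forall n, dominated_additive mu C (k n)) ->
  (forall eps, 0 < eps -> exists (I : countType) (B : I -> set X),
    [/\ (forall i, measurable (B i)), \bigcup_i B i = setT
      & forall i A, measurable A -> A `<=` B i -> forall e, 0 < e ->
          \forall n \near \oo, `|k n A| <= eps * prob A + e]) ->
  forall A, measurable A -> k n A @[n --> \oo] --> 0.
Proof.
move=> kC kloc D mD; apply/cvgr0Pnorm_le => eps0 eps0_gt0.
(* One share each for the proportional error, the accumulated slack and the uncovered tail. *)
have [eps eps_gt0 eps3] : exists2 eps, 0 < eps & eps0 = 3 * eps.
  by exists (eps0 / 3); [rewrite divr_gt0|rewrite mulrCA divff ?mulr1].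
have [I [B [mB BT kB]]] := kloc _ eps_gt0.
(* The cells are enumerated through their codes in [nat]; a number that codes no index receives the
   empty cell. *)
pose B' n := if unpickle n is Some i then D `&` B i else set0.
have mB' n : measurable (B' n).
  by rewrite /B'; case: unpickle => // i; exact: measurableI.
pose E n := seqDU B' n.
have mbig n : measurable (\big[setU/set0]_(i < n) B' i).
  by apply: bigsetU_measurable.
have mE n : measurable (E n) by apply: measurableD.
pose U n := \big[setU/set0]_(i < n) E i.
have mU n : measurable (U n) by apply: bigsetU_measurable.
have EB' : \bigcup_n E n = D.
  rewrite -seqDU_bigcup_eq; apply/seteqP; split.
    by move=> x [n _]; rewrite /B'; case: unpickle => // i [].
  move=> x Dx; have : (\bigcup_i B i) x by rewrite BT.
  by move=> [i _ Bix]; exists (pickle i) => //; rewrite /B' pickleK.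
have UD : \bigcup_n U n = D.
  rewrite -EB'; apply/seteqP; split=> x [n _].
    by rewrite /U -bigcup_mkord => -[i _ Eix]; exists i.
  by move=> Enx; exists n.+1 => //; rewrite /U -bigcup_mkord; exists n => /=.
have ndU : nondecreasing_seq U.
  move=> i j ij; apply/subsetPset; rewrite /U -!bigcup_mkord => x [l /= li Elx].
  by exists l => //=; exact: leq_trans ij.
(* The slack [e] is general in the induction, so it can be halved between the earlier cells and the
   new one. *)
have kU J e : 0 < e -> \forall n \near \oo, `|k n (U J)| <= eps * prob (U J) + e.
  elim: J e => [|J IHJ] e e0.
    near=> n; rewrite /U big_ord0 (dominated_additive0 (kC n)) normr0.
    by rewrite addr_ge0 ?mulr_ge0 ?prob_ge0 1?ltW.
  have UE : U J `&` E J = set0.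
    apply: (trivIset_bigsetUI (D := xpredT)) => //.
    by apply: sub_trivIset (trivIset_seqDU B').
  have US : U J.+1 = U J `|` E J by rewrite /U big_ord_recr.
  near=> n; rewrite US (kC n).1// (dominated_additive_prob mu).1//.
  apply: le_trans (ler_normD _ _) _.
  have : `|k n (U J)| <= eps * prob (U J) + e / 2.
    by near: n; apply: IHJ; rewrite divr_gt0.
  have : `|k n (E J)| <= eps * prob (E J) + e / 2.
    near: n; case E_J : (unpickle J) => [i|].
      apply: (kB i) => //; last by rewrite divr_gt0.
      by apply: subset_trans (@subset_seqDU _ B' J) _; rewrite /B' E_J; exact: subIsetr.
    have -> : E J = set0.
      rewrite -subset0; apply: subset_trans (@subset_seqDU _ B' J) _.
      by rewrite /B' E_J.
    apply: filterE => m; rewrite (dominated_additive0 (kC m)) normr0.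
    by rewrite addr_ge0 ?mulr_ge0 ?prob_ge0 1?ltW// divr_gt0.
  rewrite mulrDr; lra.
have [J CJ] : exists J, C * (prob D - prob (U J)) <= eps.
  have : C * (prob D - prob (U n)) @[n --> \oo] --> C * (prob D - prob D).
    apply: cvgMr; apply: cvgB; first exact: cvg_cst.
    by have := prob_cvg_bigcup (mu := mu) mU ndU; rewrite UD.
  rewrite subrr mulr0 => /cvgr0_norm_le/(_ _ eps_gt0)[J _ /(_ J (leqnn J))].
  by exists J; apply: le_trans (ler_norm _) _.
near=> n.
have UJD : U J `<=` D by rewrite -UD; exact: bigcup_sup.
have := dominated_additive_dist (kC n) (mU J) mD UJD.
have : `|k n (U J)| <= eps * prob (U J) + eps by near: n; exact: kU.
have : eps * prob (U J) <= eps.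
  by rewrite ler_piMr ?prob_le1// ltW.
have := lerB_dist (k n D) (k n (U J)).
rewrite eps3; lra.
Unshelve. all: by end_near. Qed.

End local.

(** * Integrals of bounded functions *)

Section bounded_integrals.
Context d (X : measurableType d) (R : realType) (mu : probability X R).
Local Notation prob := (prob mu).
Implicit Types (f : X -> R) (A S : set X) (M : R).

Lemma bounded_integrable f A M : measurable A -> measurable_fun setT f ->
  (forall x, A x -> `|f x| <= M) -> mu.-integrable A (EFin \o f).
Proof.
move=> mA mf fM; apply: measurable_bounded_integrable => //.
- by rewrite ltey_eq fin_num_measure.
- exact: measurable_funTS.
- exists M; split; first exact: num_real.
  by move=> K MK x /= Ax; rewrite (le_trans (fM _ Ax))// ltW.
Qed.

Lemma Rintegral_norm_le f A M : measurable A -> measurable_fun setT f ->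
  (forall x, A x -> `|f x| <= M) -> `|\int[mu]_(x in A) f x| <= M * prob A.
Proof.
move=> mA mf fM; have intf := bounded_integrable mA mf fM.
apply: le_trans (le_normr_Rintegral mA intf) _.
rewrite -[leRHS]Rintegral_cst//; apply: le_Rintegral => //.
- apply: (@bounded_integrable _ _ M) => //; first exact: measurableT_comp.
  by move=> x Ax; rewrite normr_id fM.
- by apply: (@bounded_integrable _ _ `|M|).
Qed.

Lemma Rintegral_dominated_additive f M : measurable_fun setT f ->
  (forall x, `|f x| <= M) ->
  dominated_additive mu M (fun A => \int[mu]_(x in A) f x).
Proof.
move=> mf fM; split=> [A B mA mB AB|A mA]; last exact: Rintegral_norm_le.
rewrite Rintegral_setU//; last by rewrite disj_set2E AB.
by apply: (@bounded_integrable _ _ M) => //; exact: measurableU.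
Qed.

Lemma Rintegral_norm_le_outside f A S M e : measurable A -> measurable S ->
  measurable_fun setT f -> (forall x, `|f x| <= M) -> 0 <= M -> 0 <= e ->
  (forall x, ~ S x -> `|f x| <= e) ->
  `|\int[mu]_(x in A) f x| <= e * prob A + M * prob S.
Proof.
move=> mA mS mf fM M0 e0 fe.
have mAS := measurableI _ _ mA mS; have mAS' := measurableD mA mS.
rewrite -[in leLHS](setUIDK A S) (Rintegral_dominated_additive mf fM).1//; last first.
  by rewrite setDE setIACA setICr setI0.
apply: le_trans (ler_normD _ _) _; rewrite addrC lerD//.
- have := @Rintegral_norm_le f (A `\` S) e mAS' mf.
  move=> /(_ (fun x Ax => fe x Ax.2)) /le_trans; apply.
  by apply: ler_wpM2l => //; exact: prob_le.
- have := @Rintegral_norm_le f (A `&` S) M mAS mf (fun x _ => fM x).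
  move=> /le_trans; apply.
  by apply: ler_wpM2l => //; exact: prob_le.
Qed.

Lemma Rintegral_preimage (T : X -> X) f A M : measurable_fun setT T ->
  (forall B, measurable B -> mu (T @^-1` B) = mu B) ->
  measurable A -> measurable_fun setT f -> (forall x, `|f x| <= M) ->
  \int[mu]_(x in T @^-1` A) f (T x) = \int[mu]_(x in A) f x.
Proof.
move=> mT Tmu mA mf fM; rewrite /Rintegral; congr fine.
have mTA : measurable (T @^-1` A) by rewrite -[_ @^-1` _]setTI; exact: mT.
have := @integral_pushforward _ _ _ _ _ _ mT mu A (EFin \o f).
rewrite /comp/= => <- //.
- apply: eq_measure_integral => B mB _.
  by rewrite /= /pushforward; exact: (Tmu B mB).
- exact/measurable_EFinP.
- exact: (@bounded_integrable (f \o T) _ M mTA (measurableT_comp mf mT)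
    (fun x _ => fM (T x))).
Qed.

End bounded_integrals.

(** * Countable covers on which a function varies little *)

Section dense_cover.
Context d (X : measurableType d) (R : realType).

(** Rational centres keep the cover countable, as [local_cvg] requires; on each slab [f] is within
    [e] of a constant. *)
Definition rat_slab (f : X -> R) (e : R) (r : rat) : set X :=
  [set x | `|f x - ratr r| < e].

Lemma measurable_rat_slab (f : X -> R) e r : measurable_fun setT f ->
  measurable (rat_slab f e r).
Proof.
move=> mf.
have mg : measurable_fun setT (fun x => `|f x - ratr r|).
  apply: measurableT_comp => //; exact: measurable_funB.
have := mg measurableT `]-oo, e[%classic (measurable_itv _).
by rewrite setTI.
Qed.

Lemma rat_slab_cover (f : X -> R) e x : 0 < e -> exists r, rat_slab f e r x.
Proof.
move=> e0; have /rat_in_itvoo[r] : f x - e < f x + e by lra.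
rewrite in_itv/= => /andP[r1 r2]; exists r; rewrite /rat_slab/= ltr_norml.
by apply/andP; split; lra.
Qed.

End dense_cover.

Lemma measurable_iter d (X : measurableType d) (T : X -> X) n :
  measurable_fun setT T -> measurable_fun setT (iter n T).
Proof.
move=> mT; elim: n => [|n IHn]; first exact: measurable_id.
exact: (measurableT_comp mT IHn).
Qed.

Lemma measurable_symdiff d (X : measurableType d) (A B : set X) :
  measurable A -> measurable B -> measurable (symdiff A B).
Proof. by move=> mA mB; apply: measurableU; exact: measurableD. Qed.

Lemma fine_cvg0 (R : realType) (u : nat -> \bar R) :
  u n @[n --> \oo] --> 0%E -> fine (u n) @[n --> \oo] --> 0.
Proof. exact: fine_cvg. Qed.

Lemma measurable_oscillation d (X : measurableType d) (R : realType)
    (T : X -> X) (f : X -> R) (e : R) n :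
  measurable_fun setT T -> measurable_fun setT f ->
  measurable [set x | e <= `|f (iter n T x) - f x|].
Proof.
move=> mT mf; have mg : measurable_fun setT (fun x => `|f (iter n T x) - f x|).
  apply: measurableT_comp => //; apply: measurable_funB => //.
  exact: (measurableT_comp mf (measurable_iter n mT)).
have := mg measurableT `[e, +oo[%classic (measurable_itv _).
rewrite setTI; congr (measurable _).
by apply/seteqP; split=> x /=; rewrite in_itv/= andbT.
Qed.

(** * Rigidity as convergence in measure *)

Section rigidity.
Context d (X : measurableType d) (R : realType) (mu : probability X R).
Local Notation prob := (prob mu).

(** If [x] and its image under [iter (q n) T] lie in the same slab of radius [e / 2], the
    oscillation is below [e]. So inside a slab the bad set lies in the symmetric difference of the
    slab and its preimage, which rigidity makes small on [W n]. *)
Lemma rigidity_in_measure (T : X -> X) (q : nat -> nat) (W : nat -> set X)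
    (f : X -> R) (e : R) :
  measurable_fun setT T -> measurable_fun setT f ->
  (forall n, measurable (W n)) -> rigidity_seq mu T q W -> 0 < e ->
  prob ([set x | e <= `|f (iter (q n) T x) - f x|] `&` W n) @[n --> \oo] --> 0.
Proof.
move=> mT mf mW rig e0; pose S n := [set x | e <= `|f (iter (q n) T x) - f x|].
have mS n : measurable (S n) by exact: measurable_oscillation.
have mSW n := measurableI _ _ (mS n) (mW n).
pose k n A := prob (A `&` (S n `&` W n)).
have kC n : dominated_additive mu 1 (k n).
  split=> [A B mA mB AB|A mA].
    rewrite /k setIUl (dominated_additive_prob mu).1//; try exact: measurableI.
    by rewrite setIACA AB set0I.
  rewrite mul1r ger0_norm ?prob_ge0//; apply: prob_le => //.
  exact: measurableI.
suff : k n setT @[n --> \oo] --> 0 by under eq_fun do rewrite /k setTI.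
apply: (local_cvg kC) => // eps eps0.
have e2 : 0 < e / 2 by rewrite divr_gt0.
have mB r := measurable_rat_slab (e / 2) r mf.
exists rat, (rat_slab f (e / 2)); split => //.
  apply/seteqP; split=> // x _; have [r xr] := rat_slab_cover f x e2.
  by exists r.
move=> r A mA AB e' e'0.
have := fine_cvg0 (rig _ (mB r)) => /cvgr0_norm_le/(_ _ e'0).
apply: filterS => n; rewrite ger0_norm ?prob_ge0// => le_e'.
rewrite ger0_norm ?prob_ge0//.
have : k n A <= prob (symdiff (iter (q n) T @^-1` rat_slab f (e / 2) r)
    (rat_slab f (e / 2) r) `&` W n).
  apply: prob_le; first exact: measurableI.
    apply: measurableI => //; apply: measurable_symdiff => //.
    by rewrite -[_ @^-1` _]setTI; exact: measurable_iter.
  move=> x [/AB Bx [Sx Wx]]; split=> //; right; split=> // Tx.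
  move: Sx Bx Tx; rewrite /S/rat_slab/= => Sx.
  rewrite !ltr_norml => /andP[? ?] /andP[? ?].
  by move: Sx; rewrite leNgt ltr_norml => /negP; apply; apply/andP; split; lra.
move=> /le_trans/(_ le_e') kle; rewrite (le_trans kle)// lerDr.
by rewrite mulr_ge0 ?prob_ge0// ltW.
Qed.

End rigidity.

(** * Uniform continuity and measurability on the plane *)

(** The bound on values is non-strict so that it passes to integrals against [P]. *)
Definition coord_unif_continuous (R : realType) (phi : R * R -> R) :=
  forall e, 0 < e -> exists2 delta, 0 < delta & forall z w : R * R,
    `|z.1 - w.1| < delta -> `|z.2 - w.2| < delta -> `|phi z - phi w| <= e.

Lemma unif_continuous_coord (R : realType) (phi : R * R -> R) :
  unif_continuous phi -> coord_unif_continuous phi.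
Proof.
move=> uphi e e0.
have /uphi : entourage [set xy : R * R | ball xy.1 e xy.2].
  by rewrite -entourage_ballE; exists e.
rewrite /nbhs/= -entourage_ballE => -[delta /= delta0 phie].
exists delta => // z w zw1 zw2.
by apply: ltW; apply: (phie (z, w)); split.
Qed.

Lemma coord_unif_continuous_continuous (R : realType) (phi : R * R -> R) :
  coord_unif_continuous phi -> continuous phi.
Proof.
move=> uphi z; apply/cvgrPdist_le => e /uphi[delta delta0 phie].
exists (ball z.1 delta, ball z.2 delta) => /=.
  by split; exact: nbhsx_ballx.
by move=> w [? ?]; exact: phie.
Qed.

(** Measurability here refers to the product sigma-algebra; an open set is the union of the
    countably many rational squares it contains. *)
Lemma open_measurable_prod (R : realType) (O : set (R * R)) :
  open O -> measurable O.
Proof.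
move=> oO.
pose sq (r s t : rat) : set (R * R) :=
  rat_slab fst (ratr t) r `&` rat_slab snd (ratr t) s.
have -> : O = \bigcup_r \bigcup_s \bigcup_t
    (if `[< sq r s t `<=` O >] then sq r s t else set0).
  apply/seteqP; split=> [z Oz|z [r _ [s _ [t _]]]]; last first.
    by case: asboolP => // + sqz; exact.
  have /nbhs_ballP[e /= e0 zO] : nbhs z O by exact: open_nbhs_nbhs.
  (* With half-side below [e / 2], a square containing [z] stays in the ball of radius [e] around
     [z]. *)
  have [t] : exists t : rat, ratr t \in `]0, e / 2[.
    by apply: rat_in_itvoo; rewrite divr_gt0.
  rewrite in_itv/= => /andP[t0 te].
  have [r zr] := rat_slab_cover fst z t0.
  have [s zs] := rat_slab_cover snd z t0.
  exists r => //; exists s => //; exists t => //.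
  have sqO : sq r s t `<=` O.
    move=> w [wr ws]; apply: zO; split.
      move: zr wr; rewrite /rat_slab/= /ball/= !ltr_norml.
      by move=> /andP[? ?] /andP[? ?]; apply/andP; split; lra.
    move: zs ws; rewrite /rat_slab/= /ball/= !ltr_norml.
    by move=> /andP[? ?] /andP[? ?]; apply/andP; split; lra.
  by rewrite asboolT.
do 3 (apply: bigcupT_measurable_rat => ?).
case: asboolP => // _.
by apply: measurableI; apply: measurable_rat_slab;
  [exact: measurable_fst|exact: measurable_snd].
Qed.

Lemma continuous_measurable_prod (R : realType) (phi : R * R -> R) :
  continuous phi -> measurable_fun setT phi.
Proof.
move=> /continuousP cphi; apply: (measurability _ (RGenOpens.measurableE R)).
move=> _ [_ [a [b ->]] <-]; rewrite setTI; apply: open_measurable_prod.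
by apply: cphi; exact: interval_open.
Qed.

(** * Birkhoff sums and asymptotic invariance *)

(** Telescoping. The change of a Birkhoff sum under one step of [T] becomes an oscillation of [f]
    over time [n], which rigidity controls. *)
Lemma cocycle_shift (X : Type) (R : realType) (T : X -> X) (f : X -> R) n x :
  cocycle T f n (T x) - cocycle T f n x = f (iter n T x) - f x.
Proof.
elim: n => [|n IHn]; first by rewrite /cocycle !big_ord0 /= !subrr.
move: IHn; rewrite /cocycle !big_ord_recr/= -iterSr/=; lra.
Qed.

Lemma measurable_cocycle d (X : measurableType d) (R : realType)
    (T : X -> X) (f : X -> R) n :
  measurable_fun setT T -> measurable_fun setT f ->
  measurable_fun setT (cocycle T f n).
Proof.
move=> mT mf; apply: measurable_sum => i.
exact: (measurableT_comp mf (measurable_iter i mT)).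
Qed.

Section invariance.
Context d (X : measurableType d) (R : realType) (mu : probability X R).
Variables (T : X -> X) (f : X -> R) (W : nat -> set X) (q q' : nat -> nat).
Variables (a a' : nat -> R).
Hypotheses (mT : measurable_fun setT T)
  (Tmu : forall A, measurable A -> mu (T @^-1` A) = mu A).
Hypotheses (mf : measurable_fun setT f) (mW : forall n, measurable (W n)).
Hypotheses (WT : mu (symdiff (W n) (T @^-1` W n)) @[n --> \oo] --> 0%E)
  (rigq : rigidity_seq mu T q W) (rigq' : rigidity_seq mu T q' W).
Local Notation prob := (prob mu).

Definition birkhoff_pair n x : R * R :=
  (cocycle T f (q' n) x - a' n, cocycle T f (q n) x - a n).

Lemma measurable_birkhoff_pair n : measurable_fun setT (birkhoff_pair n).
Proof.
by apply: measurable_fun_pair; apply: measurable_funB => //;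
  exact: measurable_cocycle.
Qed.

Variables (phi : R * R -> R) (M : R).
Hypotheses (phiM : forall z, `|phi z| <= M) (uphi : coord_unif_continuous phi)
  (mphi : measurable_fun setT phi).

Let u n x := \1_(W n) x * phi (birkhoff_pair n x).

Lemma measurable_localized n : measurable_fun setT (u n).
Proof.
apply: measurable_funM => //.
exact: (measurableT_comp mphi (measurable_birkhoff_pair n)).
Qed.

Lemma localized_bounded n x : `|u n x| <= M.
Proof.
rewrite /u normrM indicE; case: (_ \in _); rewrite ?normr1 ?mul1r//.
by rewrite normr0 mul0r (le_trans _ (phiM (0, 0))).
Qed.

(** Since [T] preserves [mu], the difference is the integral of [u n - u n \o T] over the preimage
    of [A]. The integrand is small except where [f] oscillates on [W n] over time [q n] or [q' n],
    or where [W n] and its preimage differ. *)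
Lemma localized_asymptotically_invariant A : measurable A ->
  \int[mu]_(x in T @^-1` A) u n x - \int[mu]_(x in A) u n x
    @[n --> \oo] --> 0.
Proof.
move=> mA; apply/cvgr0Pnorm_le => e e0.
have M0 : 0 <= M by rewrite (le_trans _ (phiM (0, 0))).
have [delta delta0 phie] := uphi (divr_gt0 e0 (ltr0n R 2)).
pose S (p : nat -> nat) n :=
  [set x | delta <= `|f (iter (p n) T x) - f x|] `&` W n.
pose D n := symdiff (W n) (T @^-1` W n).
have mTW n : measurable (T @^-1` W n) by rewrite -[_ @^-1` _]setTI; exact: mT.
have mD n : measurable (D n) by exact: measurable_symdiff.
have mS p n : measurable (S p n).
  by apply: measurableI => //; exact: measurable_oscillation.
(* [2 * M] bounds the integrand everywhere, so this dominates the contribution of the exceptional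
   set. *)
have cvgSD : 2 * M * (prob (S q n) + prob (S q' n) + prob (D n)) @[n --> \oo] --> 0.
  have -> : 0 = 2 * M * (0 + 0 + 0) :> R by rewrite !addr0 mulr0.
  apply: cvgMr.
  by apply: cvgD; [apply: cvgD; exact: rigidity_in_measure|exact: fine_cvg0].
near=> n.
have muT : measurable_fun setT (u n \o T) :=
  measurableT_comp (measurable_localized n) mT.
have mTA : measurable (T @^-1` A) by rewrite -[_ @^-1` _]setTI; exact: mT.
rewrite -(Rintegral_preimage mT Tmu mA (measurable_localized n)
  (@localized_bounded n)).
rewrite -RintegralB//; last 2 first.
- exact: (bounded_integrable mu mTA (measurable_localized n)
    (fun x _ => localized_bounded n x)).
- exact: (bounded_integrable mu mTA muT (fun x _ => localized_bounded n (T x))).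
have mU : measurable (S q n `|` S q' n `|` D n).
  by apply: measurableU => //; exact: measurableU.
have := @Rintegral_norm_le_outside _ _ _ mu (fun x => u n x - u n (T x))
  (T @^-1` A) (S q n `|` S q' n `|` D n) (2 * M) (e / 2) mTA mU.
move/(_ _ _ _ _ _)/le_trans; apply.
- by apply: measurable_funB => //; exact: measurable_localized.
- move=> x; apply: le_trans (ler_normB _ _) _.
  by have := localized_bounded n x; have := localized_bounded n (T x); lra.
- by rewrite mulr_ge0.
- by rewrite divr_ge0 ?ltW.
(* Here [x] and [T x] are both in [W n] or both outside. In the first case [cocycle_shift] puts the
   two arguments of [phi] within [delta] in each coordinate; in the second both values vanish. *)
- move=> x /not_orP[/not_orP[Sqx Sq'x] Dx].
  have [Wx|Wx] := pselect (W n x).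
    have WTx : W n (T x) by apply: contrapT => nWTx; apply: Dx; left.
    rewrite /u !indicE !mem_set// !mul1r distrC; apply: phie => /=.
      rewrite (_ : _ - _ = cocycle T f (q' n) (T x) - cocycle T f (q' n) x);
        last lra.
      by rewrite cocycle_shift ltNge; apply/negP => ?; apply: Sq'x.
    rewrite (_ : _ - _ = cocycle T f (q n) (T x) - cocycle T f (q n) x);
      last lra.
    by rewrite cocycle_shift ltNge; apply/negP => ?; apply: Sqx.
  have WTx : ~ W n (T x) by move=> ?; apply: Dx; right.
  by rewrite /u !indicE !memNset// !mul0r subrr normr0 divr_ge0 ?ltW.
have pU : prob (S q n `|` S q' n `|` D n) <=
    prob (S q n) + prob (S q' n) + prob (D n).
  apply: le_trans (prob_setU_le mu _ _) _ => //; first exact: measurableU.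
  by rewrite lerD2r; exact: prob_setU_le.
have SDe : 2 * M * (prob (S q n) + prob (S q' n) + prob (D n)) <= e / 2.
  apply: le_trans (ler_norm _) _; near: n.
  by apply: cvgr0_norm_le => //; rewrite divr_gt0.
have : e / 2 * prob (T @^-1` A) <= e / 2.
  by rewrite ler_piMr ?prob_le1// divr_ge0// ltW.
have : 2 * M * prob (S q n `|` S q' n `|` D n) <= e / 2.
  by apply: le_trans SDe; apply: ler_wpM2l => //; rewrite mulr_ge0.
lra.
Unshelve. all: by end_near. Qed.

End invariance.

(** * Limits of integrals over sets and against bounded weights *)

Section limits.
Context d (X : measurableType d) (R : realType) (mu : probability X R).
Local Notation prob := (prob mu).

(** Subtracting the mean times [prob] gives total mass zero and keeps asymptotic invariance, as [T]
    preserves [mu]; [ergodic_cvg] then applies. *)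
Lemma asymptotically_invariant_cvg (T : X -> X) (u : nat -> X -> R) (M L : R) :
  measurable_fun setT T -> ergodic mu T ->
  (forall n, measurable_fun setT (u n)) -> (forall n x, `|u n x| <= M) ->
  (forall A, measurable A -> \int[mu]_(x in T @^-1` A) u n x -
    \int[mu]_(x in A) u n x @[n --> \oo] --> 0) ->
  (forall A, measurable A -> mu (T @^-1` A) = mu A) ->
  \int[mu]_x u n x @[n --> \oo] --> L ->
  forall A, measurable A -> \int[mu]_(x in A) u n x @[n --> \oo] --> L * prob A.
Proof.
move=> mT ergT mu_n uM uT Tmu uL A mA.
pose k n B := \int[mu]_(x in B) u n x - (\int[mu]_x u n x) * prob B.
have uC n := Rintegral_dominated_additive mu (mu_n n) (uM n).
have kC n : dominated_additive mu (2 * M) (k n).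
  split=> [B D mB mD BD|B mB].
    rewrite /k (uC n).1// (dominated_additive_prob mu).1//; ring.
  apply: le_trans (ler_normB _ _) _; rewrite mulr2n mulrDl mul1r mulrDl.
  apply: lerD; first exact: (uC n).2.
  rewrite normrM (ger0_norm (prob_ge0 _ _)) ler_wpM2r ?prob_ge0//.
  by have := (uC n).2 _ measurableT; rewrite probT mulr1.
have kT n : k n setT = 0 by rewrite /k probT mulr1 subrr.
have : k n A @[n --> \oo] --> 0.
  apply: (ergodic_cvg mT ergT kC kT) => // B mB.
  have := uT B mB; apply: cvg_trans; apply: near_eq_cvg; apply: nearW => n.
  by rewrite /k /prob Tmu//; ring.
move=> kA; rewrite -[_ * _]add0r.
have -> : (fun n => \int[mu]_(x in A) u n x) =
    (fun n => k n A + (\int[mu]_x u n x) * prob A).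
  by apply/funext => n; rewrite /k subrK.
by apply: cvgD => //; apply: cvgMl.
Qed.

(** On a slab of [g] the weight can be replaced by a rational constant, at a cost proportional to
    the measure, which [local_cvg] tolerates. *)
Lemma Rintegral_mul_bounded_cvg0 (s : nat -> X -> R) (K : R) (g : X -> R) (C : R) :
  (forall n, measurable_fun setT (s n)) -> (forall n x, `|s n x| <= K) ->
  (forall A, measurable A -> \int[mu]_(x in A) s n x @[n --> \oo] --> 0) ->
  measurable_fun setT g -> (forall x, `|g x| <= C) ->
  \int[mu]_x (s n x * g x) @[n --> \oo] --> 0.
Proof.
move=> ms sK sA mg gC.
have msg n : measurable_fun setT (fun x => s n x * g x) by exact: measurable_funM.
have sgK n x : `|s n x * g x| <= K * C by rewrite normrM ler_pM.
have kC n := Rintegral_dominated_additive mu (msg n) (sgK n).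
apply: (local_cvg kC) => // eps eps0.
have [delta delta0 Kdelta] : exists2 delta, 0 < delta & `|K| * delta <= eps.
  (* Adding [1] keeps the divisor positive even when [K] is [0]. *)
  have K1 : 0 < `|K| + 1 by rewrite ltr_pwDr.
  exists (eps / (`|K| + 1)); first exact: divr_gt0.
  rewrite mulrCA; apply: ler_piMr; first exact: ltW.
  by rewrite ler_pdivrMr// mul1r lerDl.
exists rat, (rat_slab g delta); split=> [r||r A mA Ag e e0].
- exact: measurable_rat_slab.
- apply/seteqP; split=> // x _.
  by have [r ?] := rat_slab_cover g x delta0; exists r.
have /cvgr0_norm_le/(_ _ e0) : \int[mu]_(x in A) s n x * ratr r @[n --> \oo] --> 0.
  by rewrite -(mul0r (ratr r)); apply: cvgMl; exact: sA.
apply: filterS => n; set I := _ * ratr r => Ie.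
have mr : measurable_fun setT (fun x => s n x * (g x - ratr r)).
  by apply: measurable_funM => //; exact: measurable_funB.
have mr' : measurable_fun setT (fun x => s n x * ratr r) by exact: measurable_funM.
have bnd x : A x -> `|s n x * (g x - ratr r)| <= eps.
  move=> /Ag gx; rewrite normrM (le_trans _ Kdelta)//; apply: ler_pM => //.
    exact: le_trans (sK n x) (ler_norm _).
  exact: ltW.
have intA : mu.-integrable A (EFin \o s n).
  exact: (bounded_integrable mu mA (ms n) (fun x _ => sK n x)).
have -> : \int[mu]_(x in A) (s n x * g x) =
    \int[mu]_(x in A) (s n x * (g x - ratr r)) + I.
  rewrite /I -RintegralZr// -RintegralD//.
  - by apply: eq_Rintegral => x _; ring.
  - exact: (bounded_integrable mu mA mr bnd).
  - apply: (bounded_integrable mu mA mr' (M := K * `|ratr r|)) => x _.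
    by rewrite normrM ler_wpM2r.
apply: le_trans (ler_normD _ _) _; apply: lerD => //.
exact: Rintegral_norm_le.
Qed.

End limits.

(** * Translates of the test function and their averages *)

(** Moving the shift into the test function lets weak convergence be applied for each fixed
    shift. *)
Definition translate (R : realType) (phi : R * R -> R) (v : R * R) : R * R -> R :=
  fun z => phi (z.1 + v.1, z.2 + v.2).

Section translate.
Context (R : realType) (phi : R * R -> R).
Hypothesis uphi : coord_unif_continuous phi.

Lemma coord_unif_continuous_translate v : coord_unif_continuous (translate phi v).
Proof.
move=> e /uphi[delta delta0 phie]; exists delta => // z w zw1 zw2.
apply: phie => /=.
  by rewrite (_ : _ - _ = z.1 - w.1)//; ring.
by rewrite (_ : _ - _ = z.2 - w.2)//; ring.
Qed.

Lemma coord_unif_continuous_measurable : measurable_fun setT phi.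
Proof.
exact: (continuous_measurable_prod (coord_unif_continuous_continuous uphi)).
Qed.

End translate.

Section averaged.
Context (R : realType) (P : probability (R * R)%type R) (phi : R * R -> R) (M : R).
Hypotheses (uphi : coord_unif_continuous phi) (phiM : forall z, `|phi z| <= M).

(** This is the convolution of [phi] with the reflection of [P]. *)
Definition averaged v : R := \int[P]_z translate phi v z.

Lemma measurable_translate v : measurable_fun setT (translate phi v).
Proof.
exact: (coord_unif_continuous_measurable
  (coord_unif_continuous_translate uphi v)).
Qed.

Lemma averaged_bounded v : `|averaged v| <= M.
Proof.
rewrite -[leRHS]mulr1 -(probT P); apply: Rintegral_norm_le => [//||z _].
  exact: measurable_translate.
exact: phiM.
Qed.

Lemma averaged_dist_le v w e :
  (forall z, `|translate phi v z - translate phi w z| <= e) ->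
  `|averaged v - averaged w| <= e.
Proof.
move=> vw; rewrite /averaged -RintegralB//.
- rewrite -[leRHS]mulr1 -(probT P); apply: Rintegral_norm_le => //.
  by apply: measurable_funB; exact: measurable_translate.
- exact: (bounded_integrable P measurableT (measurable_translate v)
    (fun z _ => phiM _)).
- exact: (bounded_integrable P measurableT (measurable_translate w)
    (fun z _ => phiM _)).
Qed.

Lemma translate_dist_le e : 0 < e -> exists2 delta, 0 < delta & forall v w : R * R,
  `|v.1 - w.1| < delta -> `|v.2 - w.2| < delta ->
  forall z, `|translate phi v z - translate phi w z| <= e.
Proof.
move=> /uphi[delta delta0 phie]; exists delta => // v w vw1 vw2 z.
apply: phie => /=.
  by rewrite (_ : _ - _ = v.1 - w.1)//; ring.
by rewrite (_ : _ - _ = v.2 - w.2)//; ring.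
Qed.

(** Averaging preserves the modulus of uniform continuity of [phi], and uniform continuity gives
    measurability. *)
Lemma measurable_averaged : measurable_fun setT averaged.
Proof.
apply: coord_unif_continuous_measurable => e /translate_dist_le[delta delta0 de].
by exists delta => // v w vw1 vw2; apply: averaged_dist_le => z; exact: de.
Qed.

End averaged.

Lemma bounded_integralE d (X : measurableType d) (R : realType)
    (mu : probability X R) (f : X -> R) (A : set X) (M : R) :
  measurable A -> measurable_fun setT f -> (forall x, A x -> `|f x| <= M) ->
  (\int[mu]_(x in A) (f x)%:E)%E = (\int[mu]_(x in A) f x)%:E.
Proof.
move=> mA mf fM; rewrite /Rintegral fineK//.
exact: (integrable_fin_num mA (bounded_integrable mu mA mf fM)).
Qed.

Lemma Rintegral_indic_mul d (X : measurableType d) (R : realType)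
    (mu : probability X R) (f : X -> R) (A : set X) :
  \int[mu]_x (\1_A x * f x) = \int[mu]_(x in A) f x.
Proof.
rewrite [RHS]Rintegral_mkcond; apply: eq_Rintegral => x _.
by rewrite patchE indicE; case: ifP => _; rewrite ?mul1r ?mul0r.
Qed.

(** * The limit for constant shifts, then for variable shifts *)

Section joint_limit.
Context d (X : measurableType d) (R : realType) (mu : probability X R).
Variables (T : X -> X) (f : X -> R) (W : nat -> set X) (q q' : nat -> nat).
Variables (a a' : nat -> R) (alpha : R) (P : probability (R * R)%type R).
Variables (phi : R * R -> R) (M : R).
Hypotheses (mT : measurable_fun setT T)
  (Tmu : forall A, measurable A -> mu (T @^-1` A) = mu A)
  (ergT : ergodic mu T).
Hypotheses (mf : measurable_fun setT f) (mW : forall n, measurable (W n))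
  (alpha0 : 0 <= alpha) (Walpha : mu (W n) @[n --> \oo] --> alpha%:E).
Hypotheses (WT : mu (symdiff (W n) (T @^-1` W n)) @[n --> \oo] --> 0%E)
  (rigq : rigidity_seq mu T q W) (rigq' : rigidity_seq mu T q' W).
Hypotheses (uphi : coord_unif_continuous phi) (phiM : forall z, `|phi z| <= M).
Local Notation prob := (prob mu).
Local Notation F := (birkhoff_pair T f q q' a a').
Hypothesis weakF : weak_cvg_cond mu W F P.

(** Weak convergence gives the limit over the whole space, and asymptotic invariance distributes it
    proportionally to [prob A]. *)
Lemma localized_cvg v A : measurable A ->
  \int[mu]_(x in A) (\1_(W n) x * translate phi v (F n x)) @[n --> \oo] -->
  alpha * averaged P phi v * prob A.
Proof.
move=> mA; have mphi := measurable_translate uphi v.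
have uphiv := coord_unif_continuous_translate uphi v.
have mF n : measurable_fun setT (translate phi v \o F n).
  exact: (measurableT_comp mphi (measurable_birkhoff_pair _ _ _ _ mT mf n)).
have intE n : (\int[mu]_(x in W n) (translate phi v (F n x))%:E)%E =
    (\int[mu]_(x in W n) translate phi v (F n x))%:E.
  exact: (bounded_integralE mu (mW n) (mF n) (fun x _ => phiM _)).
apply: (@asymptotically_invariant_cvg _ _ _ _ T _ M) => //.
- by move=> n; exact: measurable_localized.
- move=> n x.
  by apply: (@localized_bounded _ _ _ T f W q q' a a' _ M) => z; exact: phiM.
- move=> B mB; apply: (@localized_asymptotically_invariant _ _ _ mu T f W q q' a a'
    mT Tmu mf mW WT rigq rigq' _ M) => // z; exact: phiM.
have pW : prob (W n) @[n --> \oo] --> alpha by exact: fine_cvg.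
have := weakF (coord_unif_continuous_continuous uphiv).
move=> /(_ (ex_intro _ M (fun z => phiM _))).
rewrite (bounded_integralE P measurableT mphi (fun z _ => phiM _)).
under eq_fun do rewrite intE -EFinM.
move=> /fine_cvg/= cond.
have -> : (fun n => \int[mu]_x (\1_(W n) x * translate phi v (F n x))) =
    (fun n => prob (W n) * ((prob (W n))^-1 *
      \int[mu]_(x in W n) translate phi v (F n x))).
  apply/funext => n; rewrite Rintegral_indic_mul.
  (* When [W n] is null the factor cannot be cancelled, but both sides are then [0]. *)
  have [W0|W0] := eqVneq (prob (W n)) 0; last by rewrite mulVKf.
  rewrite W0 mul0r; apply/eqP; rewrite -normr_le0 -(mulr0 M) -W0.
  exact: (Rintegral_norm_le mu (mW n) (mF n) (fun x _ => phiM _)).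
exact: cvgM pW cond.
Qed.

Variables (h h' g : X -> R) (C : R).
Hypotheses (mh : measurable_fun setT h) (mh' : measurable_fun setT h').
Hypotheses (mg : measurable_fun setT g) (gC : forall x, `|g x| <= C).

Let H x := (h' x, h x).
Let G := averaged P phi.

(** The integrand minus its expected limit, before weighting by [g]. *)
Let s n x := \1_(W n) x * translate phi (H x) (F n x) - alpha * G (H x).

Let mH : measurable_fun setT H.
Proof. exact: measurable_fun_pair. Qed.

Let mGH : measurable_fun setT (G \o H).
Proof. exact: (measurableT_comp (measurable_averaged P uphi phiM) mH). Qed.

Let mphiH n : measurable_fun setT (fun x => translate phi (H x) (F n x)).
Proof.
have mF := measurable_birkhoff_pair q q' a a' mT mf n.
have [mF1 mF2] := (measurable_fun_pairP _).1 mF.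
apply: (measurableT_comp (coord_unif_continuous_measurable uphi)).
by apply: measurable_fun_pair; apply: measurable_funD.
Qed.

Let ms n : measurable_fun setT (s n).
Proof.
apply: measurable_funB; first exact: measurable_funM.
exact: measurable_funM.
Qed.

Let indic_mul_le n x (y : R) : `|\1_(W n) x * y| <= `|y|.
Proof.
rewrite normrM indicE; case: (_ \in _); rewrite ?normr1 ?mul1r//.
by rewrite normr0 mul0r.
Qed.

Let s_bounded n x : `|s n x| <= M + alpha * M.
Proof.
apply: le_trans (ler_normB _ _) _; apply: lerD.
  exact: le_trans (indic_mul_le _ _ _) (phiM _).
by rewrite normrM (ger0_norm alpha0) ler_wpM2l// averaged_bounded.
Qed.

(** On a cell where [h'] and [h] are nearly constant, the shift is frozen at a rational point [v],
    for which [localized_cvg] gives the limit. *)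
Let s_cvg A : measurable A -> \int[mu]_(x in A) s n x @[n --> \oo] --> 0.
Proof.
have kC n := Rintegral_dominated_additive mu (ms n) (s_bounded n).
apply: (local_cvg kC) => eps eps0.
(* Freezing the shift costs one such error in the translate and [alpha] times it in the average, in
   total [eps]. *)
have e0 : 0 < eps / (1 + alpha) by rewrite divr_gt0// ltr_pwDl.
have [delta delta0 de] := translate_dist_le uphi e0.
exists (rat * rat)%type,
  (fun r => rat_slab h' delta r.1 `&` rat_slab h delta r.2).
split=> [r||r B mB Br e' e'0].
- by apply: measurableI; exact: measurable_rat_slab.
- apply/seteqP; split=> // x _.
  have [r1 ?] := rat_slab_cover h' x delta0.
  by have [r2 ?] := rat_slab_cover h x delta0; exists (r1, r2).
pose v : R * R := (ratr r.1, ratr r.2).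
pose sv n x := \1_(W n) x * translate phi v (F n x) - alpha * G v.
have mtv n : measurable_fun setT (fun x => \1_(W n) x * translate phi v (F n x)).
  apply: measurable_funM => //.
  exact: (measurableT_comp (measurable_translate uphi v)
    (measurable_birkhoff_pair _ _ _ _ mT mf n)).
have tvM n x : `|\1_(W n) x * translate phi v (F n x)| <= M.
  exact: le_trans (indic_mul_le _ _ _) (phiM _).
have msv n : measurable_fun setT (sv n) by apply: measurable_funB.
have svM n x : `|sv n x| <= M + `|alpha * G v|.
  by apply: le_trans (ler_normB _ _) _; exact: lerD.
have : \int[mu]_(x in B) sv n x @[n --> \oo] --> 0.
  have -> : (fun n => \int[mu]_(x in B) sv n x) = (fun n =>
      \int[mu]_(x in B) (\1_(W n) x * translate phi v (F n x)) -
      alpha * G v * prob B).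
    apply/funext => n; rewrite -Rintegral_cst// -RintegralB//.
    - exact: (bounded_integrable mu mB (mtv n) (fun x _ => tvM n x)).
    - by apply: (@bounded_integrable _ _ _ mu _ _ `|alpha * G v|).
  apply/subr_cvg0; exact: localized_cvg.
move=> /cvgr0_norm_le/(_ _ e'0); apply: filterS => n sve.
have -> : \int[mu]_(x in B) s n x =
    \int[mu]_(x in B) (s n x - sv n x) + \int[mu]_(x in B) sv n x.
  rewrite [X in _ = X + _]RintegralB ?subrK//.
  - exact: (bounded_integrable mu mB (ms n) (fun x _ => s_bounded n x)).
  - exact: (bounded_integrable mu mB (msv n) (fun x _ => svM n x)).
apply: le_trans (ler_normD _ _) _; apply: lerD => //.
apply: Rintegral_norm_le => //; first exact: measurable_funB.
move=> x /Br[xr1 xr2].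
have dex z := de (H x) v xr1 xr2 z.
have -> : s n x - sv n x =
    \1_(W n) x * (translate phi (H x) (F n x) - translate phi v (F n x)) -
    alpha * (G (H x) - G v).
  by rewrite /s /sv; ring.
have -> : eps = eps / (1 + alpha) + alpha * (eps / (1 + alpha)).
  by rewrite -[X in X + _]mul1r -mulrDl mulrCA divff ?mulr1// gt_eqF// ltr_pwDl.
apply: le_trans (ler_normB _ _) _; apply: lerD.
  exact: le_trans (indic_mul_le _ _ _) (dex _).
rewrite normrM (ger0_norm alpha0) ler_wpM2l//.
exact: averaged_dist_le.
Qed.

(** The difference of the two sides is the integral of [s n x * g x], so convergence over sets
    upgrades to the bounded weight [g]. *)
Lemma joint_limit_bounded :
  \int[mu]_(x in W n) (translate phi (H x) (F n x) * g x) @[n --> \oo] -->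
  alpha * \int[mu]_x (G (H x) * g x).
Proof.
have M0 : 0 <= M := le_trans (normr_ge0 _) (phiM (0, 0)).
have sg := Rintegral_mul_bounded_cvg0 ms s_bounded s_cvg mg gC.
have mGg : measurable_fun setT (fun x => G (H x) * g x) by exact: measurable_funM.
have Gg x : `|G (H x) * g x| <= M * C.
  by rewrite normrM; apply: ler_pM => //; exact: averaged_bounded.
have mtg n : measurable_fun setT
    (fun x => \1_(W n) x * (translate phi (H x) (F n x) * g x)).
  by apply: measurable_funM => //; exact: measurable_funM.
have tg n x : `|\1_(W n) x * (translate phi (H x) (F n x) * g x)| <= M * C.
  apply: le_trans (indic_mul_le _ _ _) _; rewrite normrM.
  by apply: ler_pM => //; exact: phiM.
have mCGg : measurable_fun setT (fun x => alpha * (G (H x) * g x)).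
  exact: measurable_funM.
apply/subr_cvg0; apply: cvg_trans sg; apply: near_eq_cvg; apply: nearW => n.
rewrite -(Rintegral_indic_mul mu _ (W n)) -RintegralZl//; last first.
  exact: (bounded_integrable mu measurableT mGg (fun x _ => Gg x)).
rewrite -RintegralB//.
- by apply: eq_Rintegral => x _; rewrite /s; ring.
- exact: (bounded_integrable mu measurableT (mtg n) (fun x _ => tg n x)).
- apply: (bounded_integrable mu measurableT mCGg (M := alpha * (M * C))) => x _.
  by rewrite normrM (ger0_norm alpha0) ler_wpM2l.
Qed.

End joint_limit.

(** * Reduction to a weight bounded everywhere, and passage to extended reals *)

Theorem theorem3p4 (R : realType) (d : measure_display) (X : measurableType d)
  (mu : probability X R) (T : X -> X) (f : X -> R) (c : R)
  (W : nat -> set X) (q q' : nat -> nat) (a a' : nat -> R) (alpha : R)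
  (P : probability (R * R)%type R)
  (h h' g : X -> R) (phi : (R * R)%type -> R) :
  standard_borel X R -> nonatomic mu ->
  mp_automorphism mu T -> ergodic mu T ->
  measurable_fun setT f -> mu.-integrable setT (fun x => (f x ^+ 2)%:E) ->
  0 < c -> (forall x, c <= f x) ->
  (forall n, measurable (W n)) ->
  {homo q : m n / (m < n)%N >-> (m < n)%N} ->
  {homo q' : m n / (m < n)%N >-> (m < n)%N} ->
  0 < alpha <= 1 ->
  let fn := fun n x => cocycle T f (q n) x - a n in
  let fn' := fun n x => cocycle T f (q' n) x - a' n in
  (* (C1) *) (fun n => mu (W n)) @ \oo --> alpha%:E ->
  (* (C2) *) (fun n => mu (symdiff (W n) (T @^-1` W n))) @ \oo --> 0%E ->
  (* (C3) *) rigidity_seq mu T q W ->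
  (* (C4) *) rigidity_seq mu T q' W ->
  (* (C5) *) (exists M : R, forall n,
                (\int[mu]_(x in W n) (`|fn n x| ^+ 2)%:E <= M%:E)%E) ->
  (* (C6) *) (exists M : R, forall n,
                (\int[mu]_(x in W n) (`|fn' n x| ^+ 2)%:E <= M%:E)%E) ->
  (* (C7) *) weak_cvg_cond mu W
               (fun n x => (fn' n x, fn n x)) P ->
  measurable_fun setT h -> measurable_fun setT h' ->
  measurable_fun setT g -> (exists M : R, {ae mu, forall x, `|g x| <= M}) ->
  (exists M : R, forall z, `|phi z| <= M) -> unif_continuous phi ->
  (fun n => \int[mu]_(x in W n)
              (phi (fn' n x + h' x, fn n x + h x) * g x)%:E)%E @ \oo -->
    (alpha%:E * \int[mu]_x \int[P]_z
       (phi (z.1 + h' x, z.2 + h x) * g x)%:E)%E.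
Proof.
move=> _ _ [_ mT _ Tmu] ergT mf _ _ _ mW _ _ /andP[alpha0 _] fn fn'.
move=> Walpha WT rigq rigq' _ _ weakF mh mh' mg [C gC] [M phiM] uphi0.
have uphi := unif_continuous_coord uphi0.
pose D := [set x | `|g x| <= C].
have mD : measurable D.
  have mng : measurable_fun setT (fun x => `|g x|) by exact: measurableT_comp.
  by have := mng measurableT `]-oo, C]%classic (measurable_itv _); rewrite setTI.
(* [g] is bounded only almost everywhere; cutting it off outside [D] gives an everywhere bounded
   representative, which changes neither integral. *)
pose g' x := g x * \1_D x.
have mg' : measurable_fun setT g' by exact: measurable_funM.
have g'C x : `|g' x| <= `|C|.
  rewrite /g' indicE; case: (boolP (x \in D)) => [/[!inE] Dx|_].
    by rewrite mulr1 (le_trans Dx)// ler_norm.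
  by rewrite mulr0 normr0.
have g'g : {ae mu, forall x, g x = g' x}.
  by apply: filterS gC => x Dx; rewrite /g' indicE mem_set// mulr1.
pose H x := (h' x, h x).
pose F := birkhoff_pair T f q q' a a'.
have mH : measurable_fun setT H by exact: measurable_fun_pair.
have mGH : measurable_fun setT (averaged P phi \o H).
  exact: (measurableT_comp (measurable_averaged P uphi phiM) mH).
have mphiH n : measurable_fun setT (fun x => translate phi (H x) (F n x)).
  have mF := measurable_birkhoff_pair q q' a a' mT mf n.
  have [mF1 mF2] := (measurable_fun_pairP _).1 mF.
  apply: (measurableT_comp (coord_unif_continuous_measurable uphi)).
  by apply: measurable_fun_pair; apply: measurable_funD.
have lhsE n :
    (\int[mu]_(x in W n) (phi (fn' n x + h' x, fn n x + h x) * g x)%:E)%E =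
    (\int[mu]_(x in W n) (translate phi (H x) (F n x) * g' x))%:E.
  rewrite -(@bounded_integralE _ _ _ mu _ _ (M * `|C|) (mW n)); last 2 first.
  - exact: measurable_funM.
  - by move=> x _; rewrite normrM; apply: ler_pM => //; exact: phiM.
  apply: ae_eq_integral => //.
  - by apply/measurable_EFinP/measurable_funTS; exact: (measurable_funM (mphiH n) mg).
  - by apply/measurable_EFinP/measurable_funTS; exact: measurable_funM.
  - by apply: filterS g'g => x -> _.
(* For fixed [x] the factor [g x] is constant in [z], so this holds at every point with the original
   [g]; the cutoff enters only in the outer integral. *)
have innerE x : (\int[P]_z (phi (z.1 + h' x, z.2 + h x) * g x)%:E)%E =
    (averaged P phi (H x) * g x)%:E.
  have mphi := measurable_translate uphi (H x).
  rewrite (@bounded_integralE _ _ _ P (fun z => translate phi (H x) z * g x) _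
    (M * `|g x|))//.
  - rewrite RintegralZr//.
    exact: (bounded_integrable P measurableT mphi (fun z _ => phiM _)).
  - exact: measurable_funM.
  - by move=> z _; rewrite normrM ler_wpM2r//; exact: phiM.
have -> : (alpha%:E *
    \int[mu]_x \int[P]_z (phi (z.1 + h' x, z.2 + h x) * g x)%:E)%E =
    (alpha * \int[mu]_x (averaged P phi (H x) * g' x))%:E.
  rewrite EFinM; congr (_ * _)%E.
  under eq_integral do rewrite innerE.
  rewrite -(@bounded_integralE _ _ _ mu _ _ (M * `|C|) measurableT); last 2 first.
  - exact: measurable_funM.
  - move=> x _; rewrite normrM.
    by apply: ler_pM => //; exact: (averaged_bounded P uphi phiM).
  apply: ae_eq_integral => //.
  - by apply/measurable_EFinP; exact: measurable_funM.
  - by apply/measurable_EFinP; exact: measurable_funM.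
  - by apply: filterS g'g => x -> _.
under eq_fun do rewrite lhsE.
apply: cvg_EFin; first exact: nearW.
exact: (joint_limit_bounded mT Tmu ergT mf mW (ltW alpha0) Walpha WT rigq rigq'
  uphi phiM weakF mh mh' mg' g'C).
Qed.
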